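(* Let $u$ be the solution of $$u_t=u_{xx},\quad 0<x<a,\ 0<t<T,$$ $$u_x(0,t)=u^{-p}(0,t),\quad u_x(a,t)=(1-u(a,t))^{-q},\quad 0<t<T,$$ $$u(x,0)=u_0(x),\quad 0\le x\le a,$$ with quenching time $T$. If $u_0$ satisfies $$u_{xx}(x,0)\le 0\quad\text{and}\quad u_x(x,0)\ge \frac{a-x}{a}\,u^{-p}(x,0)\qquad\text{for } 0<x<a,$$ then there exists a positive constant $C_4$ such that $$u(0,t)\le C_4(T-t)^{1/(2p+2)}$$ for $t$ sufficiently close to the quenching time $T$.
   Context: Standing assumptions: $a,p,q>0$ are constants. The initial function $u_0$ is a non-negative smooth function on $[0,a]$ satisfying the compatibility conditions $u_0'(0)=u_0^{-p}(0)$ and $u_0'(a)=(1-u_0(a))^{-q}$. The quenching time of the solution is the finite time $T=T(u_0)<\infty$ such that $\lim_{t\to T^-}\min\{u(x,t):0\le x\le a\}=0$ or $\lim_{t\to T^-}\max\{u(x,t):0\le x\le a\}=1$. *)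

(* Defs.v *)
From HB Require Import structures.
From mathcomp Require Import all_boot all_order all_algebra.
From mathcomp Require Import all_classical all_reals all_analysis.

Set Implicit Arguments.
Unset Strict Implicit.
Unset Printing Implicit Defensive.

Import Order.TTheory GRing.Theory Num.Theory.
Import numFieldNormedType.Exports.

Local Open Scope classical_set_scope.
Local Open Scope ring_scope.

Section Quenching.
Context {R : realType}.

(* Differentiation of functions on a set A: the increment keeps y in A, so on
   A = [0, a] this is the usual derivative in ]0, a[ and the one-sided
   derivative at the end points; at points of A only the values of f on A
   matter. *)
Definition diffquot (f : R -> R) (x y : R) : R := (f y - f x) / (y - x).

Definition derivable_in (A : set R) (f : R -> R) (x : R) : Prop :=
  cvg (diffquot f x y @[y --> within A x^']).

Definition derive_in (A : set R) (f : R -> R) (x : R) : R :=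
  lim (diffquot f x y @[y --> within A x^']).

Definition smooth_in (A : set R) (f : R -> R) : Prop :=
  forall (n : nat) (x : R), A x -> derivable_in A (iter n (derive_in A) f) x.

(* Partial derivatives of u, a function of (x, t) with x in [0, a]. *)
Definition dx (a : R) (u : R -> R -> R) (x t : R) : R :=
  derive_in `[0, a] (u^~ t) x.

Definition dxx (a : R) (u : R -> R -> R) (x t : R) : R :=
  derive_in `[0, a] ((dx a u)^~ t) x.

Definition dt (u : R -> R -> R) (x t : R) : R := derive1 (u x) t.

(* 0 `^ r is a junk value for r < 0, and so is b `^ r for b < 0: the
   positivity of u0 0 and 1 - u0 a is what gives a meaning to the
   compatibility conditions. *)
Record initial_datum (a p q : R) (u0 : R -> R) : Prop := InitialDatum {
  datum_smooth : smooth_in `[0, a] u0 ;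
  datum_ge0 : forall x, x \in `[0, a] -> 0 <= u0 x ;
  datum_left_gt0 : 0 < u0 0 ;
  datum_right_lt1 : u0 a < 1 ;
  datum_compat_left : derive_in `[0, a] u0 0 = u0 0 `^ (- p) ;
  datum_compat_right : derive_in `[0, a] u0 a = (1 - u0 a) `^ (- q)
}.

(* Classical solutions on [0, a] x [0, T[: u continuous up to the parabolic
   boundary, u_x continuous up to the lateral boundary, u_xx and u_t
   continuous inside. As for the datum, the sign conditions on the lateral
   boundary are those under which the fluxes make sense. *)
Record classical_solution (a p q T : R) (u0 : R -> R) (u : R -> R -> R) :
    Prop := ClassicalSolution {
  sol_cont : {within `[0, a] `*` `[0, T[,
    continuous (fun z : R * R => u z.1 z.2)} ;
  sol_derivable_x : forall x t, x \in `[0, a] -> t \in `]0, T[ ->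
    derivable_in `[0, a] (u^~ t) x ;
  sol_dx_cont : {within `[0, a] `*` `]0, T[,
    continuous (fun z : R * R => dx a u z.1 z.2)} ;
  sol_derivable_xx : forall x t, x \in `]0, a[ -> t \in `]0, T[ ->
    derivable_in `[0, a] ((dx a u)^~ t) x ;
  sol_dxx_cont : {within `]0, a[ `*` `]0, T[,
    continuous (fun z : R * R => dxx a u z.1 z.2)} ;
  sol_derivable_t : forall x t, x \in `]0, a[ -> t \in `]0, T[ ->
    derivable (u x) t 1 ;
  sol_dt_cont : {within `]0, a[ `*` `]0, T[,
    continuous (fun z : R * R => dt u z.1 z.2)} ;
  sol_heat : forall x t, x \in `]0, a[ -> t \in `]0, T[ ->
    dt u x t = dxx a u x t ;
  sol_left_gt0 : forall t, t \in `]0, T[ -> 0 < u 0 t ;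
  sol_right_lt1 : forall t, t \in `]0, T[ -> u a t < 1 ;
  sol_flux_left : forall t, t \in `]0, T[ -> dx a u 0 t = u 0 t `^ (- p) ;
  sol_flux_right : forall t, t \in `]0, T[ ->
    dx a u a t = (1 - u a t) `^ (- q) ;
  sol_initial : forall x, x \in `[0, a] -> u x 0 = u0 x
}.

(* For t in [0, T[ a solution is continuous on the compact set [0, a], so that
   inf and sup are its minimum and maximum. *)
Definition quenches_at (a T : R) (u : R -> R -> R) : Prop :=
  inf [set u x t | x in `[0, a]] @[t --> T^'-] --> (0 : R) \/
  sup [set u x t | x in `[0, a]] @[t --> T^'-] --> (1 : R).

End Quenching.

(* Main.v *)
Require Import Defs.
From HB Require Import structures.
From mathcomp Require Import all_boot all_order all_algebra.
From mathcomp Require Import all_classical all_reals all_analysis.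
From mathcomp Require Import ring lra.

Set Implicit Arguments.
Unset Strict Implicit.
Unset Printing Implicit Defensive.

Import Order.TTheory GRing.Theory Num.Theory.
Import numFieldNormedType.Exports.

Local Open Scope classical_set_scope.
Local Open Scope ring_scope.

(** The bound follows from comparison principles alone.  Since [u0] is concave,
    it is a supersolution, so [u <= u0], and comparing [u] with its time
    translates shows that [u] is nonincreasing in time; in particular only
    quenching to [0] can occur.  As [u0] is nondecreasing in [x] and the flux
    at [a] is nonnegative, the minimum of [u] over [0, a] is [m = u(0, t)].
    While [u(0, s) >= m / 2] the flux at [0] is at most [(m / 2)^-p], and a
    quadratic subsolution shows that removing [m / 2] with this flux takes a
    time at least [c m^(2p+2)].  Hence [T - t >= c u(0, t)^(2p+2)].  This
    argument avoids differentiating [u(0, t)] in time or the equation in [x],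
    neither of which a classical solution allows. *)

(** * Derivatives within a set, and necessary conditions at a minimum *)

Section DerivativeWithin.
Context {R : realType}.
Implicit Types (A : set R) (f g : R -> R) (x y l m b c : R).

Definition has_derive A f x l : Prop :=
  diffquot f x y @[y --> within A x^'] --> l.

Lemma has_derive_near A f x l : has_derive A f x l ->
  forall e, 0 < e -> exists2 d, 0 < d & forall y, A y -> y != x ->
    `|x - y| < d -> `|l - diffquot f x y| < e.
Proof.
move=> /cvgrPdist_lt fl e /fl.
rewrite /within /dnbhs /within /= => /nbhs_ballP[d d0 dP].
by exists d => // y Ay yx xyd; apply: dP.
Qed.

Lemma has_derive_ext A f g x l : A x -> {in A, f =1 g} ->
  has_derive A f x l -> has_derive A g x l.
Proof.
move=> Ax fg; apply: cvg_trans; apply: near_eq_cvg.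
apply: filterS (withinT A _) => y Ay.
by rewrite /diffquot !fg// inE.
Qed.

(** No derivability is assumed: the two filters of difference quotients coincide, so even default
    values of [lim] agree. *)
Lemma derive_in_ext A f g x : A x -> {in A, f =1 g} ->
  derive_in A f x = derive_in A g x.
Proof.
move=> Ax fg; rewrite /derive_in; congr (lim _).
have sub h k : {in A, h =1 k} ->
    diffquot h x @ within A x^' `<=` diffquot k x @ within A x^'.
  move=> hk; apply: near_eq_cvg.
  apply: filterS (withinT A _) => y Ay.
  by rewrite /diffquot !hk// inE.
by apply/seteqP; split; apply: sub => y Ay; rewrite fg.
Qed.

Lemma has_deriveD A f g x l m : has_derive A f x l -> has_derive A g x m ->
  has_derive A (fun y => f y + g y) x (l + m).
Proof.
move=> fl gm; rewrite /has_derive.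
rewrite (_ : diffquot _ x = fun y => diffquot f x y + diffquot g x y).
  exact: cvgD.
by apply/funext => y; rewrite /diffquot; ring.
Qed.

Lemma has_deriveZ A f k x l : has_derive A f x l ->
  has_derive A (fun y => k * f y) x (k * l).
Proof.
move=> fl; rewrite /has_derive.
rewrite (_ : diffquot _ x = fun y => k * diffquot f x y).
  exact: cvgMr.
by apply/funext => y; rewrite /diffquot; ring.
Qed.

Lemma has_deriveB A f g x l m : has_derive A f x l -> has_derive A g x m ->
  has_derive A (fun y => f y - g y) x (l - m).
Proof.
move=> fl gm; rewrite /has_derive.
rewrite (_ : diffquot _ x = fun y => diffquot f x y - diffquot g x y).
  exact: cvgB.
by apply/funext => y; rewrite /diffquot; ring.
Qed.

Lemma has_derive_cst A k x : has_derive A (fun=> k) x 0.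
Proof.
rewrite /has_derive (_ : diffquot _ x = fun=> 0); first exact: cvg_cst.
by apply/funext => y; rewrite /diffquot subrr mul0r.
Qed.

Lemma is_derive_within A f x l : is_derive x 1 f l -> has_derive A f x l.
Proof.
move=> [dfx <-]; apply/cvgrPdist_lt => e e0.
move: dfx => /cvgrPdist_lt/(_ _ e0).
rewrite -[lim _]/('D_1 f x).
rewrite /within /dnbhs /within /= => /nbhs_ballP[d d0 dP].
apply/nbhs_ballP; exists d => //= y xyd yx Ay.
move: xyd (dP (y - x)); rewrite -!ball_normE /= => xyd.
rewrite sub0r normrN [`|y - x|]distrC subr_eq0 => /(_ xyd yx).
by rewrite /diffquot /GRing.scale/= mulr1 subrK [_^-1 * _]mulrC.
Qed.

Lemma has_derive_is_derive b c f x l : x \in `]b, c[ ->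
  has_derive `[b, c] f x l -> is_derive x 1 f l.
Proof.
move=> xbc fl.
suff fl' : h^-1 *: ((f \o shift x) (h *: 1) - f x) @[h --> 0^'] --> l.
  by split; [apply: cvgP fl'|apply: cvg_lim fl'].
apply/cvgrPdist_lt => e e0.
have [d d0 dP] := has_derive_near fl e0.
have /andP[bx xc] : b < x < c by rewrite in_itv in xbc.
apply/nbhs_ballP; exists (Num.min d (Num.min (x - b) (c - x))).
  by rewrite /= !lt_min d0 !subr_gt0 bx.
move=> h; rewrite -ball_normE/= sub0r normrN !lt_min => /and3P[hd].
move=> /ltr_normlP[h1 h2] /ltr_normlP[h3 h4] h0.
rewrite /GRing.scale/= mulr1 [_^-1 * _]mulrC.
have := dP (h + x); rewrite /diffquot addrK; apply.
- by rewrite /= in_itv/=; lra.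
- by rewrite -subr_eq0 addrK.
- by rewrite opprD addrCA subrr addr0 normrN.
Qed.

(** Only increments to the right are tested, so the minimum may sit at the left end point [b]; this
    handles the lateral boundary [x = 0]. *)
Lemma min_has_derive_ge0 b c f x l : x \in `[b, c[ ->
  (forall y, y \in `[b, c] -> f x <= f y) -> has_derive `[b, c] f x l -> 0 <= l.
Proof.
rewrite in_itv/= => /andP[bx xc] fmin /has_derive_near fl.
rewrite leNgt; apply/negP => l0.
have [|d d0] := fl (- l); first by rewrite oppr_gt0.
pose h := Num.min (d / 2) (c - x).
have h0 : 0 < h by rewrite lt_min subr_gt0 xc divr_gt0.
have hd : h < d by rewrite gt_min; apply/orP; left; lra.
have hc : h <= c - x by rewrite ge_min lexx orbT.
have xh : x + h \in `[b, c] by rewrite in_itv/=; lra.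
have xhx : x + h - x = h by ring.
move=> /(_ (x + h) xh); rewrite -subr_eq0 distrC xhx gtr0_norm//.
rewrite gt_eqF// => /(_ isT hd); rewrite /diffquot xhx.
rewrite ltr_norml opprK ltrBrDr gtrDl => /andP[+ _].
apply/negP; rewrite -leNgt divr_ge0 ?(ltW h0)// subr_ge0.
exact: fmin.
Qed.

(** Mirror image, with increments to the left: it serves at [x = a], and also in time, where the
    minimum may be at the final instant. *)
Lemma min_has_derive_le0 b c f x l : x \in `]b, c] ->
  (forall y, y \in `[b, c] -> f x <= f y) -> has_derive `[b, c] f x l -> l <= 0.
Proof.
rewrite in_itv/= => /andP[bx xc] fmin /has_derive_near fl.
rewrite leNgt; apply/negP => l0.
have [d d0] := fl l l0.
pose h := Num.min (d / 2) (x - b).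
have h0 : 0 < h by rewrite lt_min subr_gt0 bx divr_gt0.
have hd : h < d by rewrite gt_min; apply/orP; left; lra.
have hc : h <= x - b by rewrite ge_min lexx orbT.
have xh : x - h \in `[b, c] by rewrite in_itv/=; lra.
have xhx : x - h - x = - h by ring.
move=> /(_ (x - h) xh); rewrite -subr_eq0 distrC xhx normrN gtr0_norm//.
rewrite oppr_eq0 gt_eqF// => /(_ isT hd); rewrite /diffquot xhx.
rewrite ltr_norml => /andP[_]; rewrite ltrBlDr ltrDl.
apply/negP; rewrite -leNgt invrN mulrN oppr_le0 divr_ge0 ?(ltW h0)// subr_ge0.
exact: fmin.
Qed.

(** The first derivative vanishes at [x]; if [m < 0], then [f'] is negative just to the right of
    [x], and the mean value theorem yields a value of [f] below the minimum. *)
Lemma min_has_derive2_ge0 b c f f' x m : x \in `]b, c[ ->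
  (forall y, y \in `[b, c] -> f x <= f y) ->
  (forall y, y \in `[b, c] -> has_derive `[b, c] f y (f' y)) ->
  has_derive `[b, c] f' x m -> 0 <= m.
Proof.
move=> xbc fmin ff' f'm.
have /andP[bx xc] : b < x < c by rewrite in_itv in xbc.
have xbc' : x \in `[b, c] by rewrite in_itv/= !ltW.
have f'x0 : f' x = 0.
  apply/eqP; rewrite eq_le; apply/andP; split.
    by apply: min_has_derive_le0 fmin (ff' _ xbc'); rewrite in_itv/= bx ltW.
  by apply: min_has_derive_ge0 fmin (ff' _ xbc'); rewrite in_itv/= xc ltW.
rewrite leNgt; apply/negP => m0.
have [|d d0 dP] := has_derive_near f'm (e := - m); first by rewrite oppr_gt0.
(* Halving [c - x] keeps [[x, x + h]] inside the open interval, where the derivative is two-sided as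
   the mean value theorem requires. *)
pose h := Num.min (d / 2) ((c - x) / 2).
have h0 : 0 < h by rewrite lt_min !divr_gt0// subr_gt0.
have hd : h < d by rewrite gt_min; apply/orP; left; lra.
have hc : h <= (c - x) / 2 by rewrite ge_min lexx orbT.
have xhbc y : y \in `[x, x + h] -> y \in `]b, c[.
  by rewrite !in_itv/= => /andP[xy yh]; lra.
clearbody h.
have dfy y : y \in `[x, x + h] -> is_derive y 1 f (f' y).
  move=> /xhbc ybc; apply: (has_derive_is_derive ybc); apply: ff'.
  exact: subset_itv_oo_cc.
have xxh : x < x + h by rewrite ltrDl.
have cf : {within `[x, x + h], continuous f}.
  by apply: derivable_within_continuous => y /dfy [].
have dfo y : y \in `]x, x + h[ -> is_derive y 1 f (f' y).
  by move=> yxh; apply: dfy; exact: subset_itv_oo_cc.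
have [y yxh fxh] := MVT xxh dfo cf.
have /andP[xy yh] : x < y < x + h by rewrite in_itv in yxh.
have ybc : y \in `[b, c].
  by apply: subset_itv_oo_cc; apply: xhbc; exact: subset_itv_oo_cc.
have yxd : y - x < d by lra.
have := dP y ybc; rewrite gt_eqF// distrC gtr0_norm ?subr_gt0//.
move=> /(_ isT yxd).
rewrite /diffquot f'x0 subr0 ltr_norml opprK ltrBrDr gtrDl => /andP[+ _].
rewrite pmulr_llt0 ?invr_gt0 ?subr_gt0// => f'y0.
have : f x <= f (x + h) by apply: fmin; rewrite in_itv/=; lra.
by rewrite -subr_ge0 fxh pmulr_lge0 ?subr_gt0// leNgt f'y0.
Qed.

End DerivativeWithin.

(** * Weak minimum principle for the heat operator with Robin conditions *)

Section MinimumPrinciple.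
Context {R : realType}.
Implicit Types (a t L N x y : R).

(* [barrier a N] is even about [a / 2], solves [w'' = N ^+ 2 * w], and for
   [N] large its outward logarithmic slope at [0] and [a] exceeds any given
   Robin coefficient. *)
Definition barrier a N x : R := expR (- (N * x)) + expR (- (N * (a - x))).

Definition barrier' a N x : R :=
  N * (expR (- (N * (a - x))) - expR (- (N * x))).

Lemma barrier_gt0 a N x : 0 < barrier a N x.
Proof. by rewrite addr_gt0// expR_gt0. Qed.

Lemma is_derive_expR_comp (f : R -> R) x l : is_derive x 1 f l ->
  is_derive x 1 (fun y => expR (f y)) (l * expR (f x)).
Proof.
move=> fl; have := @is_derive1_comp _ expR f x _ _ (is_derive_expR _) fl.
by rewrite mulrC.
Qed.

Lemma is_derive_affine k b x : is_derive x 1 (fun y => k * y + b) k.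
Proof.
apply: (is_derive_eq (is_deriveD (is_deriveZ k (is_derive_id x 1))
  (is_derive_cst b x 1))).
by rewrite addr0 /GRing.scale/= mulr1.
Qed.

Lemma is_derive_barrier_left N x :
  is_derive x 1 (fun y => expR (- (N * y))) (- N * expR (- (N * x))).
Proof.
have := is_derive_expR_comp (is_derive_affine (- N) 0 x).
have E y : - N * y + 0 = - (N * y) by ring.
by under eq_fun do rewrite E; rewrite E.
Qed.

Lemma is_derive_barrier_right a N x :
  is_derive x 1 (fun y => expR (- (N * (a - y)))) (N * expR (- (N * (a - x)))).
Proof.
have := is_derive_expR_comp (is_derive_affine N (- (N * a)) x).
have E y : N * y + - (N * a) = - (N * (a - y)) by ring.
by under eq_fun do rewrite E; rewrite E.
Qed.

Lemma is_derive_barrier a N x : is_derive x 1 (barrier a N) (barrier' a N x).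
Proof.
apply: (is_derive_eq (is_deriveD (is_derive_barrier_left _ _)
  (is_derive_barrier_right _ _ _))).
by rewrite /barrier'; ring.
Qed.

Lemma is_derive_barrier' a N x :
  is_derive x 1 (barrier' a N) (N ^+ 2 * barrier a N x).
Proof.
apply: (is_derive_eq (is_deriveZ _ (is_deriveB (is_derive_barrier_right _ _ _)
  (is_derive_barrier_left _ _)))).
by rewrite /barrier /GRing.scale/=; ring.
Qed.

(** With [e = expR (- (N * a))] both claims read [L * (1 + e) < N * (1 - e)]. The term [2 / a]
    forces [N * a >= 2], hence [e <= 1 / 3], and then [2 * L < N] suffices. *)
Lemma barrier_slopes a L : 0 < a -> 0 <= L -> let N := 2 * L + 1 + 2 / a in
  L * barrier a N 0 + barrier' a N 0 < 0 /\
  0 < - L * barrier a N a + barrier' a N a.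
Proof.
move=> a0 L0 N.
have Na : 2 <= N * a.
  have -> : N * a = (2 * L + 1) * a + 2 by rewrite /N; field; rewrite gt_eqF.
  by rewrite lerDr mulr_ge0 ?(ltW a0)//; lra.
have e3 : expR (- (N * a)) <= 3^-1.
  rewrite expRN lef_pV2 ?posrE ?expR_gt0//.
  by apply: le_trans (expR_ge1Dx _); lra.
have e0 := expR_gt0 (- (N * a)).
have NL : 2 * L < N.
  by rewrite /N -addrA ltrDl addr_gt0// divr_gt0.
rewrite /barrier /barrier' !subr0 !subrr !mulr0 !oppr0 expR0.
by move: (expR _) e3 e0 => e e3 e0; split; nra.
Qed.

(** The derivatives are explicit parameters, so that solutions, their time translates, stationary
    profiles and differences all fit. They need not be continuous, nothing is differentiated at
    [t0], and the time derivative at [t1] is one-sided. *)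
Record regular a t0 t1 (z zx zxx zt : R -> R -> R) : Prop := Regular {
  regular_cont : {within `[0, a] `*` `[t0, t1],
    continuous (fun c : R * R => z c.1 c.2)} ;
  regular_dx : forall x t, x \in `[0, a] -> t \in `]t0, t1] ->
    has_derive `[0, a] (z^~ t) x (zx x t) ;
  regular_dxx : forall x t, x \in `]0, a[ -> t \in `]t0, t1] ->
    has_derive `[0, a] (zx^~ t) x (zxx x t) ;
  regular_dt : forall x t, x \in `]0, a[ -> t \in `]t0, t1] ->
    has_derive `[t0, t1] (z x) t (zt x t)
}.

Lemma regularB a t0 t1 (z zx zxx zt w wx wxx wt : R -> R -> R) :
  regular a t0 t1 z zx zxx zt -> regular a t0 t1 w wx wxx wt ->
  regular a t0 t1 (fun x t => z x t - w x t) (fun x t => zx x t - wx x t)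
    (fun x t => zxx x t - wxx x t) (fun x t => zt x t - wt x t).
Proof.
move=> [zc zdx zdxx zdt] [wc wdx wdxx wdt]; split.
- exact: within_continuousB zc wc.
- by move=> x t xa tt; apply: has_deriveB; [exact: zdx|exact: wdx].
- by move=> x t xa tt; apply: has_deriveB; [exact: zdxx|exact: wdxx].
- by move=> x t xa tt; apply: has_deriveB; [exact: zdt|exact: wdt].
Qed.

(** If [z] were negative somewhere, its quotient by the positive function [E t * barrier a N x]
    would have a negative minimum. There a positive multiple of that function added to [z] is
    minimal, which the slopes of the barrier exclude at the ends and its growth in time excludes
    inside. *)
Lemma weak_minimum_principle a t0 t1 L (z zx zxx zt : R -> R -> R) :
  0 < a -> 0 <= L -> regular a t0 t1 z zx zxx zt ->
  (forall x t, x \in `]0, a[ -> t \in `]t0, t1] -> z x t < 0 ->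
    zxx x t <= zt x t) ->
  (forall t, t \in `]t0, t1] -> z 0 t < 0 -> zx 0 t <= - L * z 0 t) ->
  (forall t, t \in `]t0, t1] -> z a t < 0 -> L * z a t <= zx a t) ->
  (forall x, x \in `[0, a] -> 0 <= z x t0) ->
  forall x t, x \in `[0, a] -> t \in `[t0, t1] -> 0 <= z x t.
Proof.
move=> a0 L0 [zc zdx zdxx zdt] zheat z0 za zinit x2 t2 x2a t2t.
rewrite leNgt; apply/negP => z2.
set N := 2 * L + 1 + 2 / a.
have [slope0 slopea] := barrier_slopes a0 L0; rewrite -/N in slope0 slopea.
(* The growth rate exceeds the factor [N ^+ 2] of the second derivative of the barrier, which makes
   the interior inequality strict. *)
pose K := N ^+ 2 + 1.
pose E t := expR (K * t).
have dE t : is_derive t 1 E (K * E t).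
  have := is_derive_expR_comp (is_derive_affine K 0 t).
  by under eq_fun do rewrite addr0; rewrite addr0.
have E0 t : 0 < E t by exact: expR_gt0.
have psi0 := barrier_gt0 a N.
pose g (c : R * R) := z c.1 c.2 / (E c.2 * barrier a N c.1).
have contf f (f' : R -> R) : (forall x, is_derive x 1 f (f' x)) ->
    continuous (f : R -> R).
  move=> ff' x; apply: differentiable_continuous.
  by apply/derivable1_diffP; case: (ff' x).
have gc : {within `[0, a] `*` `[t0, t1], continuous g}.
  move=> c; apply: cvgM; first exact: zc.
  have Ec : continuous (fun c : R * R => E c.2 * barrier a N c.1).
    move=> d; apply: cvgM.
      by apply: continuous_comp; [exact: cvg_snd|exact: contf dE _].
    apply: continuous_comp; first exact: cvg_fst.
    exact: contf (is_derive_barrier a N) _.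
  apply: cvgV; first by rewrite gt_eqF// mulr_gt0.
  exact: continuous_subspaceT Ec c.
have cpt : compact (`[0, a] `*` `[t0, t1] : set (R * R)).
  by apply: compact_setX; exact: segment_compact.
have [|[xs ts]] := compact_EVT_min _ cpt gc.
  by exists (x2, t2).
rewrite inE => -[/= xsa tst] gmin.
have gE x t : z x t = g (x, t) * (E t * barrier a N x).
  by rewrite /g/= divfK// gt_eqF// mulr_gt0.
have g2 : g (x2, t2) < 0 by rewrite /g/= pmulr_llt0// invr_gt0 mulr_gt0.
have gmin' x t : x \in `[0, a] -> t \in `[t0, t1] -> g (xs, ts) <= g (x, t).
  by move=> xa tt; apply: gmin; rewrite inE.
have gs : g (xs, ts) < 0 by apply: le_lt_trans (gmin' _ _ x2a t2t) g2.
have zs : z xs ts < 0 by rewrite gE pmulr_llt0// mulr_gt0.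
(* The minimum is not at the initial time, where [z] is nonnegative. *)
have tst' : ts \in `]t0, t1].
  move: (tst); rewrite !in_itv/= => /andP[+ ->]; rewrite andbT le_eqVlt.
  by case/predU1P => // t0s; have := zinit _ xsa; rewrite t0s leNgt zs.
(* With this multiple, [z + e * E * barrier] is nonnegative and vanishes at [(xs, ts)]. *)
pose e := - g (xs, ts).
have e0 : 0 < e by rewrite oppr_gt0.
have Yge0 x t : x \in `[0, a] -> t \in `[t0, t1] ->
    z xs ts + e * (E ts * barrier a N xs) <= z x t + e * (E t * barrier a N x).
  move=> xa tt; rewrite !gE -!mulrDl /e subrr mul0r mulr_ge0//.
    by rewrite subr_ge0 gmin'.
  by rewrite ltW// mulr_gt0.
have zsE : z xs ts = - (e * (E ts * barrier a N xs)).
  by rewrite gE /e mulNr opprK.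
pose k := e * E ts.
have k0 : 0 < k by rewrite mulr_gt0.
have Yx x : x \in `[0, a] ->
    has_derive `[0, a] (fun y => z y ts + k * barrier a N y) x
      (zx x ts + k * barrier' a N x).
  move=> xa; apply: has_deriveD; first exact: zdx.
  apply: has_deriveZ; apply: is_derive_within; exact: is_derive_barrier.
have Yxmin y : y \in `[0, a] ->
    z xs ts + k * barrier a N xs <= z y ts + k * barrier a N y.
  by move=> ya; rewrite /k -!mulrA Yge0.
have [xs0|xs0] := eqVneq xs 0.
  have : 0 <= zx 0 ts + k * barrier' a N 0.
    apply: min_has_derive_ge0 (Yx _ _).
    - by rewrite in_itv/= lexx.
    - by move=> y /Yxmin; rewrite xs0.
    - by rewrite in_itv/= lexx ltW.
  have := z0 _ tst'; move: zs zsE; rewrite xs0 mulrA -/k => zs zsE /(_ zs).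
  rewrite zsE.
  by move: slope0; rewrite -(pmulr_rlt0 _ k0); lra.
have [xsa'|xsa'] := eqVneq xs a.
  have : zx a ts + k * barrier' a N a <= 0.
    apply: min_has_derive_le0 (Yx _ _).
    - by rewrite in_itv/= lexx andbT.
    - by move=> y /Yxmin; rewrite xsa'.
    - by rewrite in_itv/= lexx ltW.
  have := za _ tst'; move: zs zsE; rewrite xsa' mulrA -/k => zs zsE /(_ zs).
  rewrite zsE.
  by move: slopea; rewrite -(pmulr_rgt0 _ k0); lra.
have xso : xs \in `]0, a[.
  by move: xsa; rewrite !in_itv/= !lt_neqAle eq_sym xs0 xsa'.
have : 0 <= zxx xs ts + k * (N ^+ 2 * barrier a N xs).
  apply: (min_has_derive2_ge0 xso Yxmin Yx).
  apply: has_deriveD; first exact: zdxx.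
  apply: has_deriveZ; apply: is_derive_within; exact: is_derive_barrier'.
have : zt xs ts + e * barrier a N xs * (K * E ts) <= 0.
  apply: (@min_has_derive_le0 _ t0 t1
    (fun t => z xs t + e * barrier a N xs * E t) ts) => //.
    by move=> t tt; rewrite -!mulrA ![barrier _ _ _ * _]mulrC Yge0.
  apply: has_deriveD; first exact: zdt.
  by apply: has_deriveZ; exact: is_derive_within.
have := zheat _ _ xso tst' zs.
have : 0 < k * barrier a N xs by rewrite mulr_gt0.
by rewrite /k /K; lra.
Qed.

End MinimumPrinciple.

(** * Comparison of sub- and supersolutions for the singular fluxes *)

Section Comparison.
Context {R : realType}.
Implicit Types (a c p q r t x y : R).

Lemma powRN_lipschitz c r x y : 0 < c -> 0 <= r -> c <= x -> x <= y ->
  x `^ (- r) - y `^ (- r) <= r * c `^ (- r) / c * (y - x).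
Proof.
move=> c0 r0 cx xy.
have x0 : 0 < x by apply: lt_le_trans cx.
have y0 : 0 < y by apply: lt_le_trans xy.
have lnxy : ln y - ln x <= (y - x) / c.
  rewrite -ln_div ?posrE//.
  have -> : y / x = 1 + (y - x) / x by field; rewrite gt_eqF.
  apply: (@le_trans _ _ ((y - x) / x)).
    apply: le_ln1Dx; apply: (@lt_le_trans _ _ 0) => //.
    by rewrite divr_ge0 ?subr_ge0// ltW.
  by rewrite ler_wpM2l ?subr_ge0// lef_pV2 ?posrE.
have xc : x `^ (- r) <= c `^ (- r).
  rewrite !powRN lef_pV2 ?posrE ?powR_gt0//.
  by apply: ge0_ler_powR => //; rewrite nnegrE ltW.
have -> : y `^ (- r) = x `^ (- r) * expR (- (r * (ln y - ln x))).
  rewrite /powR !gt_eqF// -expRD; congr expR; ring.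
have := expR_ge1Dx (- (r * (ln y - ln x))).
set e := expR _ => e1.
have px : 0 < x `^ (- r) by rewrite powR_gt0.
apply: (@le_trans _ _ (x `^ (- r) * (r * ((y - x) / c)))).
  rewrite -{1}[x `^ _]mulr1 -mulrBr ler_wpM2l ?(ltW px)//.
  have : r * (ln y - ln x) <= r * ((y - x) / c) by rewrite ler_wpM2l.
  by lra.
rewrite [leRHS](_ : _ = c `^ (- r) * (r * ((y - x) / c))); last by ring.
by rewrite ler_wpM2r// mulr_ge0// divr_ge0 ?subr_ge0// ltW.
Qed.

(** The minimum principle applies to [w - v]: where it is negative, the Lipschitz bound turns the
    flux inequalities into Robin ones. The gap [c] keeps away from the singularities, and the sum of
    the two Lipschitz constants serves at both ends. *)
Lemma flux_comparison a c p q t0 t1 (v vx vxx vt w wx wxx wt : R -> R -> R) :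
  0 < a -> 0 < c -> 0 <= p -> 0 <= q ->
  regular a t0 t1 v vx vxx vt -> regular a t0 t1 w wx wxx wt ->
  (forall t, t \in `]t0, t1] -> [/\ c <= v 0 t, c <= w 0 t,
    c <= 1 - v a t & c <= 1 - w a t]) ->
  (forall x t, x \in `]0, a[ -> t \in `]t0, t1] -> vt x t <= vxx x t) ->
  (forall x t, x \in `]0, a[ -> t \in `]t0, t1] -> wxx x t <= wt x t) ->
  (forall t, t \in `]t0, t1] -> v 0 t `^ (- p) <= vx 0 t) ->
  (forall t, t \in `]t0, t1] -> wx 0 t <= w 0 t `^ (- p)) ->
  (forall t, t \in `]t0, t1] -> vx a t <= (1 - v a t) `^ (- q)) ->
  (forall t, t \in `]t0, t1] -> (1 - w a t) `^ (- q) <= wx a t) ->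
  (forall x, x \in `[0, a] -> v x t0 <= w x t0) ->
  forall x t, x \in `[0, a] -> t \in `[t0, t1] -> v x t <= w x t.
Proof.
move=> a0 c0 p0 q0 vreg wreg bound vheat wheat v0 w0 va wa vw x t xa tt.
rewrite -subr_ge0.
pose Lp := p * c `^ (- p) / c; pose Lq := q * c `^ (- q) / c.
have Lp0 : 0 <= Lp by rewrite divr_ge0 ?mulr_ge0 ?powR_ge0// ltW.
have Lq0 : 0 <= Lq by rewrite divr_ge0 ?mulr_ge0 ?powR_ge0// ltW.
apply: (weak_minimum_principle a0 (addr_ge0 Lp0 Lq0) (regularB wreg vreg))
  xa tt => {x t}.
- by move=> x t xa tt _; rewrite lerB ?vheat ?wheat.
- move=> t tt; rewrite subr_lt0 => wv; have [_ cw _ _] := bound _ tt.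
  have := powRN_lipschitz c0 p0 cw (ltW wv).
  have := v0 _ tt; have := w0 _ tt; rewrite -/Lp.
  have : 0 <= Lq * (v 0 t - w 0 t) by rewrite mulr_ge0// subr_ge0 ltW.
  by lra.
- move=> t tt; rewrite subr_lt0 => wv; have [_ _ cv _] := bound _ tt.
  have wv' : 1 - v a t <= 1 - w a t by lra.
  have := powRN_lipschitz c0 q0 cv wv'.
  have := va _ tt; have := wa _ tt; rewrite -/Lq.
  have : 0 <= Lp * (v a t - w a t) by rewrite mulr_ge0// subr_ge0 ltW.
  by lra.
- by move=> x xa; rewrite subr_ge0 vw.
Qed.

End Comparison.

(** * Continuity of slices and translates *)

Lemma within_continuous_precomp {S U V : topologicalType} (A : set S)
    (B : set U) (h : S -> U) (f : U -> V) :
  continuous h -> (forall s, A s -> B (h s)) -> {within B, continuous f} ->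
  {within A, continuous (fun s => f (h s))}.
Proof.
move=> hc AB /subspace_continuousP fc; apply/subspace_continuousP => s As.
apply: (cvg_comp _ _ _ (fc _ (AB _ As))).
move=> P BP; have nb : nbhs s (h @^-1` [set r | B r -> P r]) := hc s _ BP.
by apply: filterS nb => r BPr Ar; apply: BPr (AB _ Ar).
Qed.

Lemma continuous_pair {T U V : topologicalType} (f : T -> U) (g : T -> V) :
  continuous f -> continuous g -> continuous (fun x => (f x, g x)).
Proof.
move=> fc gc x.
exact: (cvg_pair (F := nbhs x) (G := nbhs (f x)) (H := nbhs (g x))
  (fc x) (gc x)).
Qed.

(** * Regularity of the solution and of its datum *)

Section Solution.
Context {R : realType} (a p q T : R) (u0 : R -> R) (u : R -> R -> R).
Context (a_gt0 : 0 < a) (p_gt0 : 0 < p) (q_gt0 : 0 < q).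
Context (u0_datum : initial_datum a p q u0).
Context (u_sol : classical_solution a p q T u0 u).
Implicit Types (x t s h : R).

Lemma left_mem : 0 \in `[0, a].
Proof. by rewrite in_itv/= lexx ltW. Qed.

Lemma right_mem : a \in `[0, a].
Proof. by rewrite in_itv/= lexx ltW. Qed.

(** Monotonicity in time compares these translates; [h = 0] gives the solution itself, written at
    time [t + 0]. *)
Lemma shift_regular t0 t1 h : 0 <= t0 + h -> t1 + h < T ->
  regular a t0 t1 (fun x t => u x (t + h)) (fun x t => dx a u x (t + h))
    (fun x t => dxx a u x (t + h)) (fun x t => dt u x (t + h)).
Proof.
move=> t0h t1h.
have itvT t : t \in `]t0, t1] -> t + h \in `]0, T[.
  by rewrite !in_itv/= => /andP[tt0 tt1]; lra.
split.
- apply: (within_continuous_precomp (h := fun c : R * R => (c.1, c.2 + h)))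
    (sol_cont u_sol).
    apply: continuous_pair => c; first exact: cvg_fst.
    by apply: cvgD; [exact: cvg_snd|exact: cvg_cst].
  move=> [x t] /= [xa]; split => //=.
  by move: b; rewrite !in_itv/= => /andP[tt0 tt1]; lra.
- by move=> x t xa /itvT tT; exact: (sol_derivable_x u_sol xa tT).
- by move=> x t xa /itvT tT; exact: (sol_derivable_xx u_sol xa tT).
- move=> x t xa /itvT tT; apply: is_derive_within.
  have du : is_derive (t + h) 1 (u x) (dt u x (t + h)).
    by rewrite /dt derive1E; apply: derivableP; exact: (sol_derivable_t u_sol).
  have shift1 := is_derive_affine 1 h t.
  have E s : 1 * s + h = s + h by rewrite mul1r.
  move: shift1; under eq_fun do rewrite E.
  move=> shift1.
  have := @is_derive1_comp _ (u x) (fun s => s + h) t _ _ du shift1.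
  by rewrite mulr1.
Qed.

Lemma initial_value : {in `[0, a]%classic, u^~ 0 =1 u0}.
Proof. by move=> x; rewrite inE => xa; exact: (sol_initial u_sol). Qed.

Lemma initial_dx x : x \in `[0, a] -> dx a u x 0 = derive_in `[0, a] u0 x.
Proof. by move=> xa; apply: derive_in_ext initial_value. Qed.

(** A classical solution provides space derivatives for positive times; at time [0] they come from
    the smoothness of the datum. *)
Lemma initial_has_derive x : x \in `[0, a] ->
  has_derive `[0, a] (u^~ 0) x (dx a u x 0).
Proof.
move=> xa; have d0 := datum_smooth u0_datum (n := 0) xa.
have d0' : has_derive `[0, a] (u^~ 0) x (derive_in `[0, a] u0 x).
  apply: has_derive_ext d0 => // y ya; exact/esym/initial_value.
by rewrite initial_dx.
Qed.

Lemma initial_has_derive2 x : x \in `[0, a] ->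
  has_derive `[0, a] ((dx a u)^~ 0) x (dxx a u x 0).
Proof.
move=> xa; have d1 := datum_smooth u0_datum (n := 1) xa.
have dxE : {in `[0, a]%classic, (dx a u)^~ 0 =1 derive_in `[0, a] u0}.
  by move=> y; rewrite inE => ya; exact: initial_dx.
rewrite /dxx (derive_in_ext _ dxE)//.
by apply: has_derive_ext d1 => // y ya; exact/esym/dxE.
Qed.

(** The initial profile, frozen in time, is the supersolution of [sol_le_initial]. *)
Lemma initial_regular t0 t1 : 0 < T ->
  regular a t0 t1 (fun x=> fun=> u x 0) (fun x=> fun=> dx a u x 0)
    (fun x=> fun=> dxx a u x 0) (fun=> fun=> 0).
Proof.
move=> T_gt0; split.
- apply: (within_continuous_precomp (h := fun c : R * R => (c.1, 0)))
    (sol_cont u_sol).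
    by apply: continuous_pair => c; [exact: cvg_fst|exact: cvg_cst].
  by move=> [x t] /= [xa _]; split => //=; rewrite in_itv/= lexx.
- by move=> x t xa _; exact: initial_has_derive.
- by move=> x t /subset_itv_oo_cc xa _; exact: initial_has_derive2.
- by move=> x t _ _; exact: has_derive_cst.
Qed.

Lemma cst_regular k t0 t1 :
  regular a t0 t1 (fun=> fun=> k) (fun=> fun=> 0) (fun=> fun=> 0)
    (fun=> fun=> 0 : R).
Proof.
split; try by move=> x t _ _; exact: has_derive_cst.
by apply: continuous_subspaceT => c; exact: cvg_cst.
Qed.

Lemma sol_left_cont s t : 0 <= s -> t < T ->
  {within `[s, t], continuous (u 0)}.
Proof.
move=> s0 tT.
apply: (within_continuous_precomp (h := fun r : R => (0 : R, r)))
  (sol_cont u_sol).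
  by apply: continuous_pair => r; [exact: cvg_cst|exact: cvg_id].
move=> r /=; rewrite in_itv/= => /andP[sr rt].
split => /=; rewrite in_itv/= ?lexx ?(ltW a_gt0)//.
by rewrite (le_trans s0 sr) (le_lt_trans rt tT).
Qed.

Lemma sol_right_cont s t : 0 <= s -> t < T ->
  {within `[s, t], continuous (u a)}.
Proof.
move=> s0 tT.
apply: (within_continuous_precomp (h := fun r : R => (a, r))) (sol_cont u_sol).
  by apply: continuous_pair => r; [exact: cvg_cst|exact: cvg_id].
move=> r /=; rewrite in_itv/= => /andP[sr rt].
split => /=; rewrite in_itv/= ?lexx ?(ltW a_gt0)//.
by rewrite (le_trans s0 sr) (le_lt_trans rt tT).
Qed.

Lemma left_gt0 t : t \in `[0, T[ -> 0 < u 0 t.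
Proof.
rewrite in_itv/= le_eqVlt => /andP[/predU1P[<-|t0] tT].
  by rewrite initial_value ?inE ?(datum_left_gt0 u0_datum)//; exact: left_mem.
by apply: (sol_left_gt0 u_sol); rewrite in_itv/= t0.
Qed.

Lemma right_lt1 t : t \in `[0, T[ -> u a t < 1.
Proof.
rewrite in_itv/= le_eqVlt => /andP[/predU1P[<-|t0] tT].
  by rewrite initial_value ?inE ?(datum_right_lt1 u0_datum)//; exact: right_mem.
by apply: (sol_right_lt1 u_sol); rewrite in_itv/= t0.
Qed.

(** Compactness of [[0, t]] provides the constant [c] that [flux_comparison] asks for. *)
Lemma boundary_gap t : 0 <= t -> t < T ->
  exists2 c, 0 < c & forall s, s \in `[0, t] -> c <= u 0 s /\ c <= 1 - u a s.
Proof.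
move=> t0 tT.
have sub s : s \in `[0, t] -> s \in `[0, T[.
  by rewrite !in_itv/= => /andP[-> st]; exact: le_lt_trans tT.
have [s1 s1t s1min] := EVT_min t0 (sol_left_cont (lexx 0) tT).
have [s2 s2t s2max] := EVT_max t0 (sol_right_cont (lexx 0) tT).
exists (Num.min (u 0 s1) (1 - u a s2)).
  by rewrite lt_min subr_gt0 left_gt0 ?right_lt1 ?sub.
move=> s st; rewrite !ge_min s1min//; split => //.
by rewrite lerB ?orbT// s2max.
Qed.

Lemma initial_flux_left : dx a u 0 0 = u 0 0 `^ (- p).
Proof.
rewrite initial_dx ?left_mem// (datum_compat_left u0_datum) initial_value//.
by rewrite inE; exact: left_mem.
Qed.

Lemma initial_flux_right : dx a u a 0 = (1 - u a 0) `^ (- q).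
Proof.
rewrite initial_dx ?right_mem// (datum_compat_right u0_datum) initial_value//.
by rewrite inE; exact: right_mem.
Qed.

(** * Monotonicity in time and location of the minimum *)

Section Monotonicity.
Context (u_concave : forall x : R, 0 < x < a -> dxx a u x 0 <= 0).
Context (u_incr : forall x : R, 0 < x < a -> 0 <= dx a u x 0).

Lemma sol_le_initial x t : x \in `[0, a] -> t \in `[0, T[ -> u x t <= u x 0.
Proof.
move=> xa; rewrite in_itv/= => /andP[t0 tT].
have [c c0 cP] := boundary_gap t0 tT.
have ureg := @shift_regular 0 t 0.
rewrite -{1}[t]addr0; move: tT; rewrite -{1}[t]addr0 => tT.
have T0 : 0 < T by rewrite (le_lt_trans t0)// -[t]addr0.
have tin s : s \in `]0, t] -> s + 0 \in `]0, T[.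
  by rewrite !addr0 !in_itv/= in tT * => /andP[-> st]; exact: le_lt_trans tT.
have t00 : 0 \in `[0, t] by rewrite in_itv/= lexx.
apply: (flux_comparison a_gt0 c0 (ltW p_gt0) (ltW q_gt0)
  (ureg _ tT) (initial_regular 0 t T0)) xa _.
- by rewrite addr0.
- move=> s st; have [c1 c2] := cP _ (subset_itv_oc_cc st).
  by have [c3 c4] := cP _ t00; rewrite addr0.
- by move=> y s ya /tin sT; rewrite (sol_heat u_sol).
- by move=> y s ya _; rewrite u_concave//; rewrite in_itv in ya.
- by move=> s /tin sT; rewrite (sol_flux_left u_sol).
- by move=> s _; rewrite initial_flux_left.
- by move=> s /tin sT; rewrite (sol_flux_right u_sol).
- by move=> s _; rewrite initial_flux_right.
- by move=> y ya; rewrite addr0.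
- by rewrite in_itv/= t0 lexx.
Qed.

(** The solution and its translate by [t - s] obey the same equation and fluxes, and
    [sol_le_initial] orders them at time [0]. *)
Lemma sol_nonincreasing x s t : x \in `[0, a] -> 0 <= s -> s <= t -> t < T ->
  u x t <= u x s.
Proof.
move=> xa s0 st tT.
have t0 := le_trans s0 st.
pose h := t - s.
have h0 : 0 <= h by rewrite subr_ge0.
have [c c0 cP] := boundary_gap t0 tT.
have sT := le_lt_trans st tT.
have tE : t = s + h by rewrite /h addrC subrK.
rewrite [in X in X <= _]tE -[s in X in _ <= X]addr0.
have ureg := @shift_regular 0 s 0.
have vreg := @shift_regular 0 s h.
have tin r : r \in `]0, s] -> r + 0 \in `]0, T[.
  by rewrite addr0 !in_itv/= => /andP[-> rs]; exact: le_lt_trans sT.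
have tinh r : r \in `]0, s] -> r + h \in `]0, T[.
  by rewrite !in_itv/= /h => /andP[r0 rs]; lra.
apply: (flux_comparison a_gt0 c0 (ltW p_gt0) (ltW q_gt0)
  (vreg _ _) (ureg _ _)) xa _.
- by rewrite add0r.
- by rewrite -tE.
- by rewrite addr0.
- by rewrite addr0.
- move=> r; rewrite in_itv/= => /andP[r0 rs].
  have [|c1 c2] := cP (r + 0); first by rewrite addr0 in_itv/=; lra.
  have [|c3 c4] := cP (r + h); first by rewrite in_itv/= /h; lra.
  by [].
- by move=> y r ya /tinh rT; rewrite (sol_heat u_sol).
- by move=> y r ya /tin rT; rewrite (sol_heat u_sol).
- by move=> r /tinh rT; rewrite (sol_flux_left u_sol).
- by move=> r /tin rT; rewrite (sol_flux_left u_sol).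
- by move=> r /tinh rT; rewrite (sol_flux_right u_sol).
- by move=> r /tin rT; rewrite (sol_flux_right u_sol).
- move=> y ya; rewrite addr0 add0r; apply: sol_le_initial => //.
  by rewrite in_itv/= h0 /h; lra.
- by rewrite in_itv/= s0 lexx.
Qed.

Lemma initial_nondecreasing x y : x \in `[0, a] -> y \in `[0, a] -> x <= y ->
  0 < T -> u x 0 <= u y 0.
Proof.
move=> xa ya xy T_gt0.
have du z : z \in `]0, a[ -> is_derive z 1 (u^~ 0) (dx a u z 0).
  move=> za; apply: (has_derive_is_derive za); apply: initial_has_derive.
  exact: subset_itv_oo_cc.
apply: (ger0_derive1_le_cc (f := u^~ 0)) xa ya xy.
- by move=> z /du [].
- move=> z za; rewrite derive1E (@derive_val _ _ _ _ _ _ _ (du z za)).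
  by apply: u_incr; rewrite in_itv in za.
- apply: (within_continuous_precomp (h := fun r : R => (r, 0 : R)))
    (sol_cont u_sol).
    by apply: continuous_pair => r; [exact: cvg_id|exact: cvg_cst].
  by move=> r /= ra; split => //=; rewrite in_itv/= lexx.
Qed.

(** The minimum principle, with [L = 0], applies to [u] minus the constant [u 0 t]. On the left this
    difference is never negative up to time [t], by monotonicity in time; on the right the flux is
    nonnegative. *)
Lemma sol_ge_left x t : x \in `[0, a] -> t \in `[0, T[ -> u 0 t <= u x t.
Proof.
move=> xa; rewrite in_itv/= => /andP[t0 tT].
have ureg := @shift_regular 0 t 0.
have tin s : s \in `]0, t] -> s + 0 \in `]0, T[.
  by rewrite addr0 !in_itv/= => /andP[-> st]; exact: le_lt_trans tT.
rewrite -subr_ge0 -[t in X in _ <= X - _]addr0.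
apply: (weak_minimum_principle a_gt0 (lexx 0)
  (regularB (ureg _ _) (cst_regular (u 0 t) 0 t))) xa _.
- by rewrite addr0.
- by rewrite addr0.
- by move=> y s ya /tin sT _; rewrite (sol_heat u_sol).
- move=> s; rewrite addr0 in_itv/= => /andP[s0 st].
  by rewrite subr_lt0 ltNge sol_nonincreasing ?left_mem// ltW.
- move=> s /tin sT _; rewrite (sol_flux_right u_sol)// mul0r subr0.
  exact: powR_ge0.
- move=> y ya; rewrite addr0 subr_ge0.
  apply: (@le_trans _ _ (u 0 0)).
    by apply: sol_nonincreasing => //; exact: left_mem.
  apply: initial_nondecreasing => //; first exact: left_mem.
    by move: ya; rewrite in_itv/= => /andP[].
  exact: le_lt_trans tT.
- by rewrite in_itv/= t0 lexx.
Qed.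

(** * A quadratic subsolution and the half-life of the left boundary value *)

(** This exact solution of the heat equation starts below [m] at time [s0] for [b >= 0]. Its slope
    is [2 * b * l] at [0], and nonpositive at [a] once also [l <= a]. *)
Lemma parabola_regular t0 t1 m b l s0 :
  regular a t0 t1 (fun x s => m - 2 * b * (s - s0) - b * (l - x) ^+ 2)
    (fun x=> fun=> 2 * b * (l - x)) (fun=> fun=> - (2 * b))
    (fun=> fun=> - (2 * b)).
Proof.
have dl x : is_derive x 1 (fun y => l - y) (- 1).
  exact: (is_derive_eq (is_deriveB (is_derive_cst l x 1) (is_derive_id x 1))
    (sub0r _)).
have dsq x : is_derive x 1 (fun y => (l - y) ^+ 2) (- 2 * (l - x)).
  apply: (is_derive_eq (is_deriveX 2 (dl x))).
  by rewrite /GRing.scale/= expr1; ring.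
split.
- apply: continuous_subspaceT => c; apply: cvgB.
    apply: cvgB; first exact: cvg_cst.
    by apply: cvgMr; apply: cvgB; [exact: cvg_snd|exact: cvg_cst].
  apply: cvgMr; rewrite /=.
  under eq_fun do rewrite expr2.
  by rewrite expr2; apply: cvgM; apply: cvgB;
    [exact: cvg_cst|exact: cvg_fst|exact: cvg_cst|exact: cvg_fst].
- move=> x t _ _.
  rewrite (_ : 2 * b * (l - x) = 0 - b * (- 2 * (l - x))); last by ring.
  apply: has_deriveB; first exact: has_derive_cst.
  by apply: has_deriveZ; exact: is_derive_within.
- move=> x t _ _; rewrite (_ : - (2 * b) = 2 * b * (- 1)); last by ring.
  by apply: has_deriveZ; exact: is_derive_within.
- move=> x t _ _.
  rewrite (_ : - (2 * b) = 0 - 2 * b * (1 - 0) - 0); last by ring.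
  apply: has_deriveB; last exact: has_derive_cst.
  apply: has_deriveB; first exact: has_derive_cst.
  apply: has_deriveZ; apply: has_deriveB; last exact: has_derive_cst.
  by apply: is_derive_within; exact: is_derive_id.
Qed.

(* The flux at [0] is at most [(m / 2) `^ (- p)] as long as [u 0 >= m / 2], and
   such a flux needs a time of order [l ^+ 2] to remove [m / 2]. *)
Lemma left_half_life t s (m := u 0 t) (k := Num.min 1 a)
    (l := k * (m / 2) `^ (p + 1)) :
  0 <= t -> t <= s -> s < T -> s - t <= l ^+ 2 / 2 -> m / 2 <= u 0 s.
Proof.
move=> t0 ts sT stl; rewrite leNgt; apply/negP => us.
have T0 : 0 < T by exact: le_lt_trans (le_trans t0 ts) sT.
have tT := le_lt_trans ts sT.
have tin : t \in `[0, T[ by rewrite in_itv/= t0.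
have m0 : 0 < m by exact: left_gt0.
(* In [k], the bound by [1] makes the slope of the parabola dominate the flux, and the bound by [a]
   gives [l <= a]. *)
have k0 : 0 < k by rewrite lt_min ltr01.
have m1 : m <= 1.
  apply: (@le_trans _ _ (u 0 0)).
    by apply: sol_le_initial => //; exact: left_mem.
  apply: (@le_trans _ _ (u a 0)).
    by apply: initial_nondecreasing; rewrite ?left_mem ?right_mem// ltW.
  by apply/ltW/right_lt1; rewrite in_itv/= lexx.
have pw0 : 0 < (m / 2) `^ (p + 1) by rewrite powR_gt0// divr_gt0.
have l0 : 0 < l by rewrite mulr_gt0.
have la : l <= a.
  have pw1 : (m / 2) `^ (p + 1) <= 1 `^ (p + 1).
    apply: ge0_ler_powR; rewrite ?nnegrE//; [|by rewrite divr_ge0 ?ltW|lra].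
    by rewrite addr_ge0// ltW.
  rewrite powR1 in pw1; apply: (@le_trans _ _ (k * 1)).
    by rewrite ler_wpM2l// ltW.
  by rewrite mulr1 ge_min lexx orbT.
(* Then [b * l ^+ 2 = m / 4]: at [x = 0] the parabola starts at [3 * m / 4], and it loses another
   [m / 4] in time [l ^+ 2 / 2]. *)
pose b := m / (4 * l ^+ 2).
have b0 : 0 < b by rewrite divr_gt0// mulr_gt0// exprn_gt0.
have bl2 : b * l ^+ 2 = m / 4 by rewrite /b; field; rewrite gt_eqF.
have bl : (m / 2) `^ (- p) <= 2 * b * l.
  have -> : 2 * b * l = k^-1 * (m / 2) `^ (- p).
    rewrite powRN (_ : 2 * b * l = m / (2 * l)); last first.
      by rewrite /b; field; rewrite gt_eqF.
    have m20 : 0 < m / 2 by rewrite divr_gt0.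
    rewrite /l powRD; last by rewrite (gt_eqF m20) implybT.
    rewrite powRr1; last exact: ltW.
    by field; rewrite !gt_eqF// powR_gt0.
  by rewrite ler_peMl ?powR_ge0// invf_ge1// ge_min lexx.
have [r rts ur] : exists2 r, r \in `[t, s] & u 0 r = m / 2.
  apply: IVT => //; first exact: sol_left_cont.
  have mm : m / 2 <= m by lra.
  by rewrite ge_min (ltW us) orbT le_max mm.
have /andP[tr rs] : t <= r <= s by rewrite in_itv in rts.
have rs' : r < s.
  by rewrite lt_neqAle rs andbT; apply/eqP => E; move: us; rewrite -E ur ltxx.
have rT := le_lt_trans rs sT.
have rin z : z \in `]t, r] -> z + 0 \in `]0, T[.
  by rewrite addr0 !in_itv/= => /andP[z0 zr]; lra.
have ureg := @shift_regular t r 0.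
have : 0 <= u 0 (r + 0) - (m - 2 * b * (r - t) - b * (l - 0) ^+ 2).
  apply: (weak_minimum_principle a_gt0 (lexx 0)
    (regularB (ureg _ _) (parabola_regular t r m b l t))) left_mem _.
  - by rewrite addr0.
  - by rewrite addr0.
  - move=> y z ya zr _; rewrite (sol_heat u_sol)//; exact: rin.
  - move=> z zr _; have zT := rin z zr.
    rewrite (sol_flux_left u_sol)// oppr0 mul0r subr_le0 !addr0.
    apply: le_trans bl; rewrite !powRN.
    have muz : m / 2 <= u 0 z.
      rewrite -ur; apply: sol_nonincreasing => //; first exact: left_mem.
        by move: zr; rewrite in_itv/= => /andP[tz _]; lra.
      by move: zr; rewrite in_itv/= => /andP[].
    have m20 : 0 < m / 2 by rewrite divr_gt0.
    have uz0 : 0 < u 0 z by exact: lt_le_trans muz.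
    rewrite lef_pV2 ?posrE ?powR_gt0//.
    by apply: ge0_ler_powR; rewrite ?nnegrE// ltW.
  - move=> z zr _; have zT := rin z zr.
    rewrite (sol_flux_right u_sol)// mul0r.
    apply: (@le_trans _ _ (0 - 2 * b * (l - a))).
      by rewrite sub0r oppr_ge0 pmulr_rle0 ?subr_le0// mulr_gt0.
    by rewrite lerB// powR_ge0.
  - move=> y ya; rewrite addr0 subrr mulr0 subr0 subr_ge0.
    apply: (@le_trans _ _ m); last exact: sol_ge_left.
    by rewrite lerBlDr lerDl mulr_ge0 ?sqr_ge0// ltW.
  - by rewrite in_itv/= tr lexx.
rewrite addr0 subr0 bl2 ur.
(* Strictness comes from [r < s]; the comparison then gives [u 0 r > m / 2], contrary to the choice
   of [r]. *)
have : 2 * b * (r - t) < m / 4.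
  rewrite -bl2; apply: (@lt_le_trans _ _ (2 * b * (s - t))).
    by rewrite ltr_pM2l; [lra|rewrite mulr_gt0].
  rewrite (_ : b * l ^+ 2 = 2 * b * (l ^+ 2 / 2)); last by field.
  by rewrite ler_wpM2l// ltW// mulr_gt0.
by lra.
Qed.

End Monotonicity.
End Solution.

(** * The quenching rate *)

Theorem theorem3p4 (R : realType) (a p q T : R) (u0 : R -> R)
    (u : R -> R -> R)
    (a_gt0 : 0 < a) (p_gt0 : 0 < p) (q_gt0 : 0 < q) (T_gt0 : 0 < T)
    (u0_datum : initial_datum a p q u0)
    (u_sol : classical_solution a p q T u0 u)
    (u_quench : quenches_at a T u)
    (u_concave : forall x : R, 0 < x < a -> dxx a u x 0 <= 0)
    (u_slope : forall x : R, 0 < x < a ->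
       (a - x) / a * u x 0 `^ (- p) <= dx a u x 0) :
  exists2 C4 : R, 0 < C4 &
    \forall t \near T^'-, u 0 t <= C4 * (T - t) `^ (1 / (2 * p + 2)).
Proof.
have u_incr x : 0 < x < a -> 0 <= dx a u x 0.
  move=> /[dup] xa /andP[_ xa']; apply: le_trans (u_slope x xa).
  by rewrite mulr_ge0 ?powR_ge0// divr_ge0 ?subr_ge0// ltW.
pose k := Num.min 1 a.
have k0 : 0 < k by rewrite lt_min ltr01.
have t00 : 0 \in `[0, T[ by rewrite in_itv/= lexx.
have la := left_mem a_gt0.
have ne t : [set u x t | x in `[0, a]] !=set0.
  by exists (u 0 t); exists 0.
(* Otherwise the half-life estimate covers all of [[t, T[], so that [u] stays above [u 0 t / 2] and
   cannot quench to [0]. *)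
have life t : 0 <= t -> t < T ->
    (k * (u 0 t / 2) `^ (p + 1)) ^+ 2 / 2 <= T - t.
  move=> t0 tT; rewrite leNgt; apply/negP => short.
  have m0 : 0 < u 0 t.
    by apply: (left_gt0 a_gt0 u0_datum u_sol); rewrite in_itv/= t0.
  case: u_quench => lim.
    suff : u 0 t / 2 <= 0 by rewrite leNgt divr_gt0.
    apply: (cvgr_to_ge lim).
    near=> s; apply: lb_le_inf => // _ [x xa <-].
    have ts : t <= s by near: s; exact: nbhs_left_ge.
    have sT : s < T by near: s; exact: nbhs_left_lt.
    apply: (@le_trans _ _ (u 0 s)).
      apply: (left_half_life a_gt0 p_gt0 q_gt0 u0_datum u_sol u_concave u_incr
        t0 ts sT).
      by apply: le_trans (ltW short); rewrite lerD2r ltW.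
    apply: (sol_ge_left a_gt0 p_gt0 q_gt0 u0_datum u_sol u_concave u_incr)
      => //.
    by rewrite in_itv/= sT (le_trans t0 ts).
  (* Quenching to [1] is impossible, since [u x s <= u x 0 <= u a 0 < 1]. *)
  suff : 1 <= u a 0 by rewrite leNgt (right_lt1 a_gt0 u0_datum u_sol).
  apply: (cvgr_to_le lim).
  near=> s; apply: ge_sup => // _ [x xa <-].
  have ts : t <= s by near: s; exact: nbhs_left_ge.
  have sT : s < T by near: s; exact: nbhs_left_lt.
  apply: (@le_trans _ _ (u x 0)).
    apply: (sol_le_initial a_gt0 p_gt0 q_gt0 u0_datum u_sol u_concave) => //.
    by rewrite in_itv/= sT (le_trans t0 ts).
  apply: (initial_nondecreasing u0_datum u_sol u_incr) => //.
    exact: right_mem.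
  by move: xa; rewrite /= in_itv/= => /andP[].
pose r := 1 / (2 * p + 2).
exists (2 * (2 / k ^+ 2) `^ r).
  by rewrite mulr_gt0// powR_gt0// divr_gt0// exprn_gt0.
near=> t.
have t0 : 0 <= t by near: t; exact: nbhs_left_ge.
have tT : t < T by near: t; exact: nbhs_left_lt.
have m0 : 0 < u 0 t.
  by apply: (left_gt0 a_gt0 u0_datum u_sol); rewrite in_itv/= t0.
have := life t t0 tT; set n := u 0 t / 2.
have n0 : 0 < n by rewrite divr_gt0.
rewrite exprMn -[X in _ * X / _]powR_mulrn ?powR_ge0// -powRrM.
rewrite ler_pdivrMr// -ler_pdivlMl ?exprn_gt0// => bound.
have r0 : 0 <= r by rewrite divr_ge0//; lra.
have : n `^ ((p + 1) * 2%:R * r) <= (2 / k ^+ 2 * (T - t)) `^ r.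
  rewrite powRrM; apply: ge0_ler_powR => //.
  - by rewrite nnegrE powR_ge0.
  - by rewrite nnegrE mulr_ge0 ?subr_ge0 ?ltW// divr_gt0 ?exprn_gt0.
  - by rewrite (le_trans bound)// le_eqVlt; apply/orP; left; apply/eqP; ring.
have -> : (p + 1) * 2%:R * r = 1 by rewrite /r; field; lra.
rewrite (powRr1 (ltW n0)).
rewrite (@powRM _ (2 / k ^+ 2)) ?subr_ge0 ?(ltW tT) ?divr_ge0 ?sqr_ge0//.
by rewrite -/r /n; lra.
Unshelve. all: by end_near.
Qed.
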